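(* Let $R$ be a finite ring with unity and let $A$ be a finite left $R$-module. Then $A$ has the extension property with respect to the symmetrized weight composition built on $\mathrm{Aut}_R(A)$ if and only if the socle $\mathrm{soc}(A)$ is a cyclic $R$-module.
   Context: Rings are finite with unity (not necessarily commutative) and all modules are finite unital left modules. Functions are written with inputs on the left, so $a\tau$ denotes the image of $a$ under $\tau$. A linear code of length $n$ over $A$ is a left $R$-submodule of $A^n$. Symmetrized weight composition: let $G$ be a subgroup of the automorphism group $\mathrm{Aut}_R(A)$. Write $a\sim b$ for $a,b\in A$ if $a=b\tau$ for some $\tau\in G$, and let $A/G$ be the set of orbits. The symmetrized weight composition (swc) built on $G$ is the function $\mathrm{swc}:A^n\times A/G\to\mathbb{Q}$, $\mathrm{swc}(x,a)=|\{i : x_i\sim a\}|$ for $x=(x_1,\ldots,x_n)\in A^n$; it counts the components of $x$ in each orbit. A map $f:C_1\to C_2$ between codes $C_1,C_2\subset A^n$ preserves swc if $\mathrm{swc}(xf,a)=\mathrm{swc}(x,a)$ for all $x\in C_1$ and all $a\in A/G$. A $G$-monomial transformation of $A^n$ is a map $T:A^n\to A^n$ for which there are $\sigma\in S_n$ and $\tau_1,\ldots,\tau_n\in G$ with $(x_1,\ldots,x_n)T=(x_{\sigma(1)}\tau_1,\ldots,x_{\sigma(n)}\tau_n)$ for all $(x_1,\ldots,x_n)\in A^n$. $A$ has the extension property with respect to the swc built on $G$ if for every $n$ and any two linear codes $C_1,C_2\subset A^n$, every $R$-linear isomorphism $f:C_1\to C_2$ preserving swc extends to a $G$-monomial transformation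 of $A^n$. In the claim, $G=\mathrm{Aut}_R(A)$. $\mathrm{soc}(A)$ is the sum of all simple submodules of $A$; a module is cyclic if it is generated by one element. *)

(* Defs.v *)
From HB Require Import structures.
From mathcomp Require Import all_boot all_order all_algebra all_fingroup.

Set Implicit Arguments.
Unset Strict Implicit.
Unset Printing Implicit Defensive.

Import GroupScope GRing.Theory.
Local Open Scope ring_scope.

Section Modules.
Variables (R : finNzRingType) (A : finLmodType R).
Implicit Types S T : {set A}.

Definition is_submod S : bool :=
  (0 \in S) && [forall r : R, forall a in S, forall b in S, r *: a + b \in S].

Lemma is_submodP S : reflect (submod_closed S) (is_submod S).
Proof.
apply: (iffP andP) => -[S0 Slin]; split=> //.
  move=> r a b Sa Sb; move/forallP/(_ r)/forall_inP/(_ a Sa): Slin.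
  by move/forall_inP/(_ b Sb).
apply/forallP=> r; apply/forall_inP=> a Sa; apply/forall_inP=> b Sb.
exact: Slin.
Qed.

Definition is_simple_submod S : bool :=
  [&& is_submod S, S != [set 0]
    & [forall T : {set A},
         is_submod T && (T \subset S) ==> (T == [set 0]) || (T == S)]].

(* A finite sum of submodules consists of the sums of one element of each. *)
Definition soc : {set A} :=
  [set a | [exists c : {ffun {set A} -> A},
              [forall S in is_simple_submod, c S \in S]
              && (a == \sum_(S in is_simple_submod) c S)]].

Definition cyclic_submod S : Prop :=
  exists2 a, a \in S & S = [set r *: a | r : R].

Definition autR : {set {perm A}} :=
  [set s : {perm A} |
     [forall r : R, forall a, forall b, s (r *: a + b) == r *: s a + s b]].

Lemma autRP (s : {perm A}) : reflect (linear s) (s \in autR).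
Proof.
rewrite inE; apply: (iffP forallP) => [lin r a b | lin r].
  by move/(_ r)/forallP/(_ a)/forallP/(_ b)/eqP: lin.
by apply/forallP=> a; apply/forallP=> b; apply/eqP; exact: lin.
Qed.

Lemma autR_group_set : group_set autR.
Proof.
apply/group_setP; split=> [|s t /autRP lin_s /autRP lin_t].
  by apply/autRP=> r a b; rewrite !perm1.
by apply/autRP=> r a b; rewrite !permM lin_s lin_t.
Qed.

Canonical autR_group : {group {perm A}} := Group autR_group_set.

End Modules.

Section Codes.
Variables (R : finNzRingType) (A : finLmodType R).

(* A^n is {ffun 'I_n -> A} rather than 'rV[A]_n, as the latter carries no
   R-module structure when A is a module. *)
Definition linear_code n (C : {set {ffun 'I_n -> A}}) : Prop :=
  submod_closed C.

Section SWC.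
Variable G : {group {perm A}}.

(* Permutations act on the right in 'P, so that a \in orbit 'P G b iff
   a = b tau for some tau in G. *)
Definition orbits : {set {set A}} := [set orbit 'P G a | a : A].

Definition swc n (x : {ffun 'I_n -> A}) (O : {set A}) : rat :=
  #|[set i | x i \in O]|%:R.

Definition preserves_swc n (C : {set {ffun 'I_n -> A}})
    (f : {ffun 'I_n -> A} -> {ffun 'I_n -> A}) : Prop :=
  {in C, forall x, {in orbits, forall O, swc (f x) O = swc x O}}.

Definition monomial n (T : {ffun 'I_n -> A} -> {ffun 'I_n -> A}) : Prop :=
  exists (sigma : 'S_n) (tau : 'I_n -> {perm A}),
    (forall i, tau i \in G)
    /\ (forall x, T x = [ffun i => tau i (x (sigma i))]).

(* A map between codes is represented by any total function extending it;
   only its values on the source code matter. *)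
Definition linear_isom n (C1 C2 : {set {ffun 'I_n -> A}})
    (f : {ffun 'I_n -> A} -> {ffun 'I_n -> A}) : Prop :=
  [/\ forall r : R, {in C1 &, forall x y, f (r *: x + y) = r *: f x + f y},
      {in C1 &, injective f}
    & f @: C1 = C2].

Definition extension_property : Prop :=
  forall n (C1 C2 : {set {ffun 'I_n -> A}}) f,
    linear_code C1 -> linear_code C2 ->
    linear_isom C1 C2 f -> preserves_swc C1 f ->
    exists2 T, monomial T & {in C1, T =1 f}.

End SWC.
End Codes.

Arguments soc {R} A.
Arguments autR {R} A.
Arguments autR_group {R} A.
Arguments extension_property {R} A G.

(* Main.v *)
(* Call a character chi of (A, +) generating when its kernel contains no nonzero
   submodule; the extension property and the cyclicity of soc(A) are both
   equivalent to the existence of such a chi.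

   Generating character => extension.  If f preserves swc on C, then
   sum_{i,t} chi(x_i t) = sum_{i,t} chi((x f)_i t) on C, t ranging over G.
   Since chi is generating, distinct homomorphisms C -> A induce distinct characters
   of C, so orthogonality forces the multisets of G-orbits of the coordinate
   maps of the identity and of f to coincide.

   Extension => generating character.  Let I index all characters chi_i of A,
   and let theta be the character (a_i) |-> prod_i chi_i(a_i) of A^I.  For x in
   R^I let K_x be the kernel of a |-> sum_i x_i a_i.  If theta is trivial on
   some K_x, it factors as chi_j(sum_i x_i a_i), so every character of A has the form
   a |-> chi_j(x_i a) and chi_j is generating.  Otherwise
   eta = prod_x (|K_x| [0] - sum_{k in K_x} [k]) in the group ring Z[A^I] is
   G-invariant, vanishes on all cosets of all K_x, and theta(eta) <> 0.  The
   positive and negative parts of eta are the columns of two codes related by an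
   isomorphism which preserves swc and is not G-monomial.

   Generating character <=> cyclic socle.  For a submodule S of soc(A), each of
   "S is cyclic" and "S has a generating character" is equivalent to: for every
   simple U with annihilator P, |{s in S | P s = 0}| <= |R / P|. *)

Require Import Defs.
From HB Require Import structures.
From mathcomp Require Import all_boot all_order all_algebra all_fingroup.
From mathcomp Require Import all_field all_character.

Set Implicit Arguments.
Unset Strict Implicit.
Unset Printing Implicit Defensive.

Import GroupScope GRing.Theory Num.Theory.
Local Open Scope ring_scope.

(** Makes [{ffun I -> A}] available as a finite group and as a finite module, the forms in which it
    is used below. *)
HB.saturate finfun_of.

(** * Characters of finite abelian groups *)

Section AdditiveCharacters.

Definition additive_char (V : zmodType) (phi : V -> algC) : Prop :=
  phi 0 = 1 /\ {morph phi : x y / x + y >-> x * y}.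

Lemma additive_charN (V : zmodType) (phi : V -> algC) x :
  additive_char phi -> phi (- x) * phi x = 1.
Proof. by move=> [phi0 phiD]; rewrite -phiD addNr. Qed.

Lemma additive_char_mul (V : zmodType) (phi psi : V -> algC) :
  additive_char phi -> additive_char psi ->
  additive_char (fun x => phi x * psi x).
Proof.
move=> [phi0 phiD] [psi0 psiD]; split=> [|x y].
  by rewrite phi0 psi0 mulr1.
by rewrite phiD psiD mulrACA.
Qed.

Lemma additive_char_comp (V W : zmodType) (f : W -> V) (phi : V -> algC) :
  f 0 = 0 -> {morph f : x y / x + y} -> additive_char phi ->
  additive_char (phi \o f).
Proof.
by move=> f0 fD [phi0 phiD]; split=> [|x y] /=; rewrite ?f0 // fD phiD.
Qed.

Variable V : finZmodType.
Implicit Types (H : {set V}) (i : Iirr [set: V]).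

(** Translation by [y] in [H] permutes [H] and multiplies the sum by [phi y], so a value
    [phi y != 1] forces the sum to vanish. Multiplicativity is asked on [H] alone because [phi] will
    come from maps that are linear only on a code. *)
Lemma sum_char_subgroup H (phi : V -> algC) :
    zmod_closed H -> phi 0 = 1 ->
    {in H &, {morph phi : x y / x + y >-> x * y}} ->
  \sum_(x in H) phi x = #|H|%:R *+ [forall x in H, phi x == 1].
Proof.
move=> [H0 HB] phi0 phiD.
have [/forall_inP triv|/forall_inPn[y Hy phiy]] :=
    boolP [forall x in H, phi x == 1].
  rewrite mulr1n -sum1_card natr_sum.
  by apply: eq_bigr => x Hx; apply/eqP/triv.
have HN x : x \in H -> - x \in H by move=> Hx; rewrite -sub0r HB.
have HD x z : x \in H -> z \in H -> x + z \in H.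
  by move=> Hx Hz; rewrite -[z]opprK HB ?HN.
rewrite mulr0n.
have E: \sum_(x in H) phi x = phi y * \sum_(x in H) phi x.
  rewrite big_distrr /= (reindex_inj (addrI y)) /=.
  apply: eq_big => [x|x Hx].
    apply/idP/idP => Hx; last exact: HD.
    by rewrite -(addKr y x) addrC HB // HN.
  apply: phiD => //; by rewrite -(addKr y x) addrC HB // HN.
have /eqP := E; rewrite -subr_eq0 -{1}[\sum_(_ in _) _]mul1r -mulrBl mulf_eq0.
by rewrite subr_eq0 eq_sym (negPf phiy) => /eqP.
Qed.

Lemma irr_additive_char i : additive_char (fun x : V => 'chi_i x).
Proof.
have lin: 'chi_i \is a linear_char.
  by have /char_abelianP := FinRing.zmod_abelian [set: V]; apply.
split=> [|x y]; first exact: lin_char1 lin.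
by apply: (lin_charM lin); rewrite inE.
Qed.

Lemma sum_irr_additive (x : V) :
  \sum_i 'chi[[set: V]]_i x = #|V|%:R *+ (x == 0).
Proof.
rewrite -cardsT; transitivity (cfReg [set: V] x); last exact: cfRegE.
rewrite cfReg_sum sum_cfunE; apply: eq_bigr => i _.
by rewrite cfunE (irr_additive_char i).1 mul1r.
Qed.

Lemma card_neq0 : #|V|%:R != 0 :> algC.
Proof. by rewrite pnatr_eq0 -lt0n; apply/card_gt0P; exists 0. Qed.

(** A device for recognising [rho]: were it orthogonal to every [psi k], pairing it with their sum,
    which is [c] times the indicator of [N], would give 0 instead of [c * #|N|]. *)
Lemma char_in_family (K : finType) (P : pred K) (psi : K -> V -> algC)
    (N : {set V}) (c : algC) (rho : V -> algC) :
    (forall k, P k -> additive_char (psi k)) -> c != 0 -> zmod_closed N ->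
    (forall v, \sum_(k | P k) psi k v = c *+ (v \in N)) ->
    additive_char rho -> {in N, forall v, rho v = 1} ->
  exists2 k, P k & rho =1 psi k.
Proof.
move=> psi_char c0 Ncl sum_psi rho_char rhoN.
have NN x : x \in N -> - x \in N by move=> Nx; rewrite -sub0r Ncl.2 ?Ncl.1.
have [/existsP[k /andP[Pk /eqfunP rho_psi]] | /existsPn noK] :=
  boolP [exists k, P k && [forall v, rho v == psi k v]]; first by exists k.
(* Otherwise rho is orthogonal to every psi k, hence to their sum. *)
have: \sum_v rho (- v) * (\sum_(k | P k) psi k v) = c * #|N|%:R.
  rewrite -sum1_card natr_sum big_distrr /= [RHS]big_mkcond.
  apply: eq_bigr => v _; rewrite sum_psi.
  by case: ifP => [Nv|]; rewrite ?mulr0n ?mulr0 // rhoN ?NN // mul1r mulr1.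
under eq_bigr => v _ do rewrite big_distrr /=.
rewrite exchange_big /= big1 => [/esym/eqP|k Pk].
  rewrite mulf_eq0 (negPf c0) pnatr_eq0 cards_eq0 => /eqP N0.
  by have := Ncl.1; rewrite N0 inE.
have rhoN_char: additive_char (fun v => rho (- v)).
  by apply: (@additive_char_comp _ _ -%R) => //; [rewrite oppr0 | exact: opprD].
have [om0 omD] := additive_char_mul rhoN_char (psi_char k Pk).
transitivity (\sum_(v in [set: V]) rho (- v) * psi k v).
  by apply: eq_bigl => v; rewrite inE.
rewrite (@sum_char_subgroup [set: V] (fun v => rho (- v) * psi k v)) //.
- case: forall_inP => // triv.
  have /negP[] := noK k; rewrite Pk; apply/forallP=> v.
  have /eqP e := triv v (in_setT v).
  rewrite -[rho v]mulr1 -e mulrA [rho v * _]mulrC.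
  by rewrite (additive_charN _ rho_char) mul1r.
- by split=> [|x y]; rewrite !inE.
Qed.

Lemma additive_char_irr (rho : V -> algC) :
  additive_char rho -> exists i, rho =1 'chi[[set: V]]_i.
Proof.
move=> rho_char.
have [| | | |k _ rhoE] := @char_in_family _ xpredT
   (fun i (x : V) => 'chi[[set: V]]_i x) [set 0] _ _ _ card_neq0 _ _ rho_char.
- by move=> k _; apply: irr_additive_char.
- by split=> [|x y]; rewrite !inE // => /eqP-> /eqP->; rewrite subr0.
- by move=> v; rewrite sum_irr_additive inE.
- by move=> v; rewrite inE => /eqP->; case: rho_char.
by exists k.
Qed.

Definition irr_annihilator H : {set Iirr [set: V]} :=
  [set i | [forall h in H, 'chi_i (h : V) == 1]].

(** Double counting of the values ['chi_i h]: summed over [h] first, only characters trivial on [H]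
    contribute, each [#|H|]; summed over [i] first, only [h = 0] contributes, namely [#|V|]. *)
Lemma card_irr_annihilator H :
  zmod_closed H -> (#|irr_annihilator H| * #|H| = #|V|)%N.
Proof.
move=> Hcl; apply/eqP; rewrite -(eqr_nat algC); apply/eqP.
transitivity (\sum_i \sum_(h in H) 'chi[[set: V]]_i h).
  rewrite natrM -sum1_card natr_sum big_distrl /= big_mkcond.
  apply: eq_bigr => i _; have [c0 cD] := irr_additive_char i.
  rewrite inE (@sum_char_subgroup H (fun x => 'chi_i x)) //.
  by case: ifP; rewrite ?mul1r.
rewrite exchange_big (bigD1 0) ?Hcl.1 //= sum_irr_additive eqxx big1 ?addr0 //.
by move=> h /andP[_ /negPf h0]; rewrite sum_irr_additive h0.
Qed.

(** Were every character trivial on [H] trivial at [v], the sum of all characters over the coset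
    [H + v] would equal the sum over [H]. The former is 0, as the coset misses 0; the latter is
    [#|V|]. *)
Lemma irr_separates H v : zmod_closed H -> v \notin H ->
  exists2 i, {in H, forall h, 'chi[[set: V]]_i h = 1} & 'chi[[set: V]]_i v != 1.
Proof.
move=> Hcl Hv.
have [/existsP[i /andP[]] | /existsPn nosep] :=
    boolP [exists i, (i \in irr_annihilator H) && ('chi[[set: V]]_i v != 1)].
  by rewrite inE => /forall_inP triv ?; exists i => // h /triv/eqP.
have: \sum_(h in H) \sum_i 'chi[[set: V]]_i (h + v) =
      \sum_(h in H) \sum_i 'chi[[set: V]]_i h.
  rewrite exchange_big [RHS]exchange_big; apply: eq_bigr => i _ /=.
  have [c0 cD] := irr_additive_char i.
  under eq_bigr => h _ do rewrite cD.
  rewrite -big_distrl /= (@sum_char_subgroup H (fun x => 'chi_i x)) //.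
  have := nosep i; rewrite inE; case: forall_inP => //= _; rewrite ?mul0r //.
  rewrite negbK => /eqP->.
  by rewrite mulr1.
rewrite big1 => [|h Hh]; last first.
  rewrite sum_irr_additive addr_eq0; case: eqP => // hv; case/negP: Hv.
  by rewrite -[v]opprK -hv -sub0r Hcl.2 ?Hcl.1.
rewrite (bigD1 0) ?Hcl.1 //= sum_irr_additive eqxx big1 ?addr0.
  by move/esym/eqP; rewrite (negPf card_neq0).
by move=> h /andP[_ /negPf h0]; rewrite sum_irr_additive h0.
Qed.

End AdditiveCharacters.

(** * Submodules, simple submodules and the socle *)

Section Submodules.
Variables (R : finNzRingType) (A : finLmodType R).
Implicit Types (S T U M N : {set A}) (r : R) (a : A).

Section Closure.
Variables (S : {set A}) (Scl : is_submod S).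

Lemma submod0 : 0 \in S.
Proof. by case/is_submodP: Scl. Qed.

Lemma submodZ r a : a \in S -> r *: a \in S.
Proof.
by move=> Sa; rewrite -[_ *: _]addr0; case/is_submodP: Scl => S0; apply.
Qed.

Lemma submodD a b : a \in S -> b \in S -> a + b \in S.
Proof.
by move=> Sa Sb; rewrite -[a]scale1r; case/is_submodP: Scl => _; apply.
Qed.

Lemma submodN a : a \in S -> - a \in S.
Proof. by move=> Sa; rewrite -scaleN1r submodZ. Qed.

Lemma submodB a b : a \in S -> b \in S -> a - b \in S.
Proof. by move=> Sa Sb; rewrite submodD ?submodN. Qed.

Lemma submod_zmod : zmod_closed S.
Proof. by split=> [|a b]; [exact: submod0 | exact: submodB]. Qed.

End Closure.

Lemma is_submodI S T : is_submod S -> is_submod T -> is_submod (S :&: T).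
Proof.
move=> Scl Tcl; apply/is_submodP; split=> [|r a b]; rewrite !inE ?submod0 //.
by move=> /andP[Sa Ta] /andP[Sb Tb]; rewrite !submodD ?submodZ.
Qed.

Lemma is_submod_set0 : is_submod [set (0 : A)].
Proof.
apply/is_submodP; split=> [|r a b]; rewrite !inE // => /eqP-> /eqP->.
by rewrite scaler0 addr0.
Qed.

Definition sumset S T : {set A} := [set s + t | s in S, t in T].

Lemma sumsetP S T a :
  reflect (exists s t, [/\ s \in S, t \in T & a = s + t]) (a \in sumset S T).
Proof.
apply: (iffP imset2P) => [[s t Ss Tt ->]|[s [t [Ss Tt ->]]]].
  by exists s, t.
by exists s t.
Qed.

Lemma is_submod_sumset S T :
  is_submod S -> is_submod T -> is_submod (sumset S T).
Proof.
move=> Scl Tcl; apply/is_submodP; split.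
  by apply/sumsetP; exists 0, 0; rewrite !submod0 ?addr0.
move=> r _ _ /sumsetP[s [t [Ss Tt ->]]] /sumsetP[s' [t' [Ss' Tt' ->]]].
apply/sumsetP; exists (r *: s + s'), (r *: t + t').
by rewrite !submodD ?submodZ // scalerDr addrACA.
Qed.

Lemma sumsetSl S T : is_submod T -> S \subset sumset S T.
Proof.
move=> Tcl; apply/subsetP=> s Ss; apply/sumsetP.
by exists s, 0; rewrite Ss submod0 ?addr0.
Qed.

Lemma sumsetSr S T : is_submod S -> T \subset sumset S T.
Proof.
move=> Scl; apply/subsetP=> s Ss; apply/sumsetP.
by exists 0, s; rewrite Ss submod0 ?add0r.
Qed.

Lemma sumset_sub S T M :
  is_submod M -> S \subset M -> T \subset M -> sumset S T \subset M.
Proof.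
move=> Mcl /subsetP SM /subsetP TM.
by apply/subsetP=> _ /sumsetP[s [t [/SM Ss /TM Tt ->]]]; apply: submodD.
Qed.

Definition multiples (I : {set R}) a : {set A} := [set r *: a | r in I].

Definition left_ideal (I : {set R}) : Prop :=
  0 \in I /\ forall r, {in I &, forall x y, r * x + y \in I}.

Lemma is_submod_multiples (I : {set R}) a :
  left_ideal I -> is_submod (multiples I a).
Proof.
move=> [I0 Icl]; apply/is_submodP; split.
  by apply/imsetP; exists 0; rewrite ?scale0r.
move=> r _ _ /imsetP[x Ix ->] /imsetP[y Iy ->]; apply/imsetP.
by exists (r * x + y); rewrite ?Icl // scalerDl scalerA.
Qed.

Lemma cyclic_submodE S a : is_submod S -> a \in S ->
  (forall s, s \in S -> exists r, s = r *: a) -> cyclic_submod S.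
Proof.
move=> Scl Sa Sgen; exists a => //; apply/setP=> s.
apply/idP/imsetP => [/Sgen[r ->]|[r _ ->]]; first by exists r.
exact: submodZ.
Qed.

Lemma simple_submod U : is_simple_submod U -> is_submod U.
Proof. by case/and3P. Qed.

Lemma simple_neq0 U : is_simple_submod U -> exists2 u, u \in U & u != 0.
Proof.
case/and3P=> Ucl U0 _; have [/existsP[u /andP[]]|/existsPn noU] :=
  boolP [exists u, (u \in U) && (u != 0)]; first by exists u.
case/eqP: U0; apply/setP=> u; rewrite inE; apply/idP/eqP => [Uu|->].
  by have := noU u; rewrite Uu negbK => /eqP.
exact: submod0.
Qed.

Lemma simple_sub U N u : is_simple_submod U -> is_submod N ->
  u \in U -> u \in N -> u != 0 -> U \subset N.
Proof.
move=> Usimple Ncl Uu Nu u0; have Ucl := simple_submod Usimple.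
have /and3P[_ _ /forallP/(_ (U :&: N))] := Usimple.
rewrite is_submodI // subsetIl /= => /orP[/eqP/setP/(_ u)|/eqP <-].
  by rewrite !inE Uu Nu (negPf u0).
exact: subsetIr.
Qed.

Lemma simple_subZ U N u r : is_simple_submod U -> is_submod N ->
  u \in U -> r *: u \in N -> r *: u != 0 -> U \subset N.
Proof.
move=> Usimple Ncl Uu Nu u0; apply: (simple_sub Usimple Ncl _ Nu u0).
by rewrite submodZ ?simple_submod.
Qed.

(** A nonzero submodule of [N] of least cardinality will do. *)
Lemma contains_simple N a : is_submod N -> a \in N -> a != 0 ->
  exists2 U, is_simple_submod U & U \subset N.
Proof.
move=> Ncl Na a0.
pose P T := [&& is_submod T, T \subset N & T != [set 0]].
have PN: P N.
  by rewrite /P Ncl subxx; apply/eqP=> /setP/(_ a); rewrite Na inE (negPf a0).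
case: (arg_minnP (fun T : {set A} => #|T|) PN) => U /and3P[Ucl UN U0] Umin.
exists U => //; apply/and3P; split=> //; apply/forallP=> T; apply/implyP.
case/andP=> Tcl TU; case: eqP => //= /eqP T0.
by rewrite eqEcard TU Umin // /P Tcl T0 (subset_trans TU UN).
Qed.

Lemma is_submod_soc : is_submod (soc A).
Proof.
apply/is_submodP; split=> [|r a b]; rewrite !inE.
  apply/existsP; exists [ffun=> 0]; apply/andP; split.
    by apply/forall_inP=> S /simple_submod Scl; rewrite ffunE submod0.
  by rewrite big1 // => S _; rewrite ffunE.
case/existsP=> c /andP[/forall_inP Pc /eqP->].
case/existsP=> d /andP[/forall_inP Pd /eqP->].
apply/existsP; exists [ffun S => r *: c S + d S]; apply/andP; split.
  apply/forall_inP=> S Ssimple; rewrite ffunE.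
  by rewrite submodD ?submodZ ?Pc ?Pd ?simple_submod.
apply/eqP; rewrite scaler_sumr -big_split /=.
by apply: eq_bigr => S _; rewrite ffunE.
Qed.

Lemma simple_sub_soc U : is_simple_submod U -> U \subset soc A.
Proof.
move=> Usimple; apply/subsetP=> u Uu; rewrite inE; apply/existsP.
exists [ffun S => if S == U then u else 0]; apply/andP; split.
  apply/forall_inP=> S Ssimple; rewrite ffunE.
  by case: eqP => [->//|_]; rewrite submod0 ?simple_submod.
rewrite (bigD1 U) //= ffunE eqxx big1 ?addr0 // => S /andP[_ /negPf SU].
by rewrite ffunE SU.
Qed.

Lemma soc_sub N : is_submod N ->
  (forall U, is_simple_submod U -> U \subset N) -> soc A \subset N.
Proof.
move=> Ncl simpleN; apply/subsetP=> a; rewrite inE.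
case/existsP=> c /andP[/forall_inP Pc /eqP->].
elim/big_rec: _ => [|S s Ssimple Ns]; first exact: submod0.
by rewrite submodD //; apply: (subsetP (simpleN S Ssimple)); apply: Pc.
Qed.

(** Choose [N] of maximal size meeting [M] trivially. A simple [U] outside [M + N] meets [M + N]
    trivially, so [N + U] still meets [M] trivially; maximality then puts [U] inside [N], a
    contradiction. *)
Lemma complement_in_soc M : is_submod M ->
  exists N, [/\ is_submod N, M :&: N = [set 0] & soc A \subset sumset M N].
Proof.
move=> Mcl; pose P N := is_submod N && (M :&: N \subset [set 0]).
have P0: P [set 0] by rewrite /P is_submod_set0 subsetIr.
case: (arg_maxnP (fun T : {set A} => #|T|) P0) => N /andP[Ncl MN] Nmax.
exists N; split=> //.
  by apply/eqP; rewrite eqEsubset MN sub1set inE !submod0.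
have Kcl := is_submod_sumset Mcl Ncl.
apply: soc_sub => // U Usimple; have Ucl := simple_submod Usimple.
apply: contraT => notUK.
have UK u : u \in U -> u \in sumset M N -> u = 0.
  by move=> Uu Ku; apply: contraNeq notUK; apply: simple_sub Uu Ku.
have PNU: P (sumset N U).
  rewrite /P is_submod_sumset //=; apply/subsetP=> m /setIP[Mm].
  case/sumsetP=> n [u [Nn Uu Em]]; rewrite {m}Em in Mm *.
  have u0: u = 0.
    apply: UK => //; apply/sumsetP; exists (n + u), (- n).
    by rewrite Mm submodN // addrC addKr.
  by rewrite u0 addr0 in Mm *; apply: (subsetP MN); rewrite inE Mm.
have /eqP NU: N == sumset N U by rewrite eqEcard sumsetSl //=; apply: Nmax.
case/negP: notUK; apply: subset_trans (sumsetSr N Mcl).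
by rewrite NU sumsetSr.
Qed.

(** * Torsion under annihilators of simple submodules, and cyclicity *)

Definition annih U : {set R} := [set r | [forall u in U, r *: u == 0]].

Lemma annihP U r : reflect {in U, forall u, r *: u = 0} (r \in annih U).
Proof.
rewrite inE; apply: (iffP forall_inP) => triv u /triv; first by move/eqP.
by move=> ->.
Qed.

Lemma annih_left_ideal U : left_ideal (annih U).
Proof.
split=> [|r x y /annihP Px /annihP Py]; apply/annihP=> u Uu.
  exact: scale0r.
by rewrite scalerDl -scalerA Px ?Py ?scaler0 ?addr0.
Qed.

Lemma annih_mulr U r p : is_submod U -> p \in annih U -> p * r \in annih U.
Proof.
move=> Ucl /annihP Pp; apply/annihP=> u Uu.
by rewrite -scalerA Pp ?submodZ.
Qed.

Lemma annihB U p q : p \in annih U -> q \in annih U -> p - q \in annih U.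
Proof.
move=> /annihP Pp /annihP Pq; apply/annihP=> u Uu.
by rewrite scalerBl Pp // Pq // subrr.
Qed.

Lemma annih_zmod U : zmod_closed (annih U).
Proof. by split; [case: (annih_left_ideal U) | exact: annihB]. Qed.

Definition torsion (P : {set R}) S : {set A} :=
  [set s in S | [forall p in P, p *: s == 0]].

Lemma torsionP (P : {set R}) S a :
  reflect (a \in S /\ {in P, forall p, p *: a = 0}) (a \in torsion P S).
Proof.
rewrite inE; apply: (iffP andP) => -[Sa Pa]; split=> //.
  by move=> p; move/forall_inP: Pa => /[apply]/eqP.
by apply/forall_inP=> p /Pa ->.
Qed.

Lemma is_submod_torsion U S : is_submod U -> is_submod S ->
  is_submod (torsion (annih U) S).
Proof.
move=> Ucl Scl; apply/is_submodP; split.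
  by apply/torsionP; split=> [|p _]; rewrite ?submod0 ?scaler0.
move=> r a b /torsionP[Sa Pa] /torsionP[Sb Pb]; apply/torsionP.
split=> [|p Pp]; first by rewrite submodD ?submodZ.
by rewrite scalerDr scalerA Pa ?annih_mulr // Pb // addr0.
Qed.

(** The bound of the torsion by |R / P|, where P is [annih U], multiplied out by |P|. *)
Definition small_torsion S : Prop :=
  forall U, is_simple_submod U ->
    (#|torsion (annih U) S| * #|annih U| <= #|R|)%N.

Lemma small_torsionS S T : T \subset S -> small_torsion S -> small_torsion T.
Proof.
move=> /subsetP TS Ssmall U Usimple; apply: leq_trans (Ssmall U Usimple).
rewrite leq_mul2r subset_leq_card ?orbT //; apply/subsetP=> a.
by case/torsionP=> Ta Pa; apply/torsionP; split; [apply: TS|].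
Qed.

(** Split the generator as [t = t0 + t1] along the torsion part [M] and a complement [N]. If
    [m = r *: t] is in [M], then [m - r *: t0 = r *: t1] lies in both [M] and [N], so [m = r *: t0]:
    thus [t0] generates [M]. *)
Lemma cyclic_small_torsion S :
  is_submod S -> S \subset soc A -> cyclic_submod S -> small_torsion S.
Proof.
move=> Scl Ssoc [t St defS] U Usimple; have Ucl := simple_submod Usimple.
set M := torsion _ S; have Mcl : is_submod M by apply: is_submod_torsion.
have [N [Ncl MN socMN]] := complement_in_soc Mcl.
have /sumsetP[t0 [t1 [Mt0 Nt1 Et]]] := subsetP socMN t (subsetP Ssoc t St).
have Mgen m : m \in M -> exists r, m == r *: t0.
  move=> Mm; have /torsionP[] := Mm; rewrite {1}defS => /imsetP[r _ Em] _.
  exists r; rewrite -subr_eq0 -in_set1 -MN inE submodB ?submodZ //=.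
  by rewrite Em Et scalerDr addrC addKr submodZ.
pose rep m := odflt 0 [pick r | m == r *: t0].
have repP m : m \in M -> m = rep m *: t0.
  move=> /Mgen[r Er]; rewrite /rep; case: pickP => [r' /eqP//|/(_ r)].
  by rewrite Er.
rewrite -cardsX -cardsT.
(* This map is injective: since [annih U] kills [t0], applying [rep m + p] to [t0] returns [m], and
   then [p] is recovered by cancellation. *)
rewrite -(@card_in_imset _ _ (fun mp : A * R => rep mp.1 + mp.2)).
  by rewrite subset_leq_card ?subsetT.
case=> [m p] [m' p'] /setXP[/= Mm Pp] /setXP[/= Mm' Pp'] E.
have Pt0 := (torsionP _ _ _ Mt0).2.
suff Emm: m = m' by move: E; rewrite Emm => /addrI->.
rewrite (repP m Mm) (repP m' Mm') -[LHS]addr0 -[RHS]addr0.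
by rewrite -{1}(Pt0 p Pp) -(Pt0 p' Pp') -!scalerDl E.
Qed.

(** If the right-hand side missed part of [T], a complement of it would contain a simple [W] inside
    [T]. Either P = [annih U] kills [W], which is then torsion, or some nonzero [p *: x] with
    [x = r *: t] in [W] lies in P t because P is also a right ideal. In both cases [W] lies in the
    sum, contradicting disjointness. *)
Lemma torsion_sum_cyclic U T t : is_simple_submod U ->
    is_submod T -> T \subset soc A -> t \in T -> T = [set r *: t | r : R] ->
  T \subset sumset (torsion (annih U) T) (multiples (annih U) t).
Proof.
move=> Usimple Tcl Tsoc Tt defT; have Ucl := simple_submod Usimple.
set M := torsion _ T; set P := annih U.
have Mcl : is_submod M by apply: is_submod_torsion.
have PtCl : is_submod (multiples P t).
  exact/is_submod_multiples/annih_left_ideal.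
have Kcl := is_submod_sumset Mcl PtCl.
have MT : M \subset T by apply/subsetP=> a /torsionP[].
have KT : sumset M (multiples P t) \subset T.
  by rewrite sumset_sub //; apply/subsetP=> _ /imsetP[p _ ->]; rewrite submodZ.
have [N [Ncl KN socKN]] := complement_in_soc Kcl.
suff NT : N :&: T \subset [set 0].
  apply/subsetP=> x Tx.
  have /sumsetP[k [n [Kk Nn Ex]]] := subsetP socKN x (subsetP Tsoc x Tx).
  have /set1P n0 : n \in [set 0].
    apply: (subsetP NT); rewrite inE Nn -(addKr k n) -Ex addrC submodB //.
    exact: (subsetP KT).
  by rewrite Ex n0 addr0.
apply/subsetP=> a NTa; rewrite inE; apply: contraT => a0.
have [W Wsimple WNT] := contains_simple (is_submodI Ncl Tcl) NTa a0.
have [w Ww w0] := simple_neq0 Wsimple.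
suff /subsetP/(_ w Ww) Kw : W \subset sumset M (multiples P t).
  have /subsetP/(_ w Ww)/setIP[Nw _] := WNT.
  by rewrite -in_set1 -KN inE Kw Nw in w0.
have WT : W \subset T by apply: subset_trans WNT (subsetIr _ _).
have [/forall_inP PW | /forall_inPn[p Pp]] :=
    boolP [forall p in P, [forall x in W, p *: x == 0]].
  apply: subset_trans (sumsetSl M PtCl); apply/subsetP=> x Wx.
  apply/torsionP; split=> [|p /PW/forall_inP/(_ x Wx)/eqP//].
  exact: (subsetP WT).
case/forall_inPn=> x Wx px0; apply: subset_trans (sumsetSr _ Mcl).
apply: (simple_subZ (r := p) (u := x)) => //.
have := subsetP WT x Wx; rewrite defT => /imsetP[r _ ->].
by rewrite scalerA; apply/imsetP; exists (p * r); rewrite ?annih_mulr.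
Qed.

(** Let [sel r] be a torsion element congruent to [r *: t] modulo P t. If [sel r = sel r'], then
    [r - r'] differs from an element of P by something killing [t], hence lies in P. So R embeds in
    the product of the torsion and P by sending [r] to [sel r] and its offset from a fixed
    representative. *)
Lemma card_torsion_cyclic U T t : is_simple_submod U ->
    is_submod T -> T \subset soc A -> t \in T -> T = [set r *: t | r : R] ->
    (forall r, r *: t = 0 -> r \in annih U) ->
  (#|R| <= #|torsion (annih U) T| * #|annih U|)%N.
Proof.
move=> Usimple Tcl Tsoc Tt defT annt; have Ucl := simple_submod Usimple.
have sumT := torsion_sum_cyclic Usimple Tcl Tsoc Tt defT.
set M := torsion _ T in sumT *; set P := annih U in annt sumT *.
pose Q r s := (s \in M) && (r *: t - s \in multiples P t).
have QP r : exists s, Q r s.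
  have /sumsetP[s [x [Ms Px E]]] := subsetP sumT _ (submodZ Tcl r Tt).
  by exists s; rewrite /Q Ms E addrC addKr.
pose sel r := odflt 0 [pick s | Q r s].
have selP r : Q r (sel r).
  have [s Qs] := QP r; rewrite /sel; case: pickP => [//|/(_ s)].
  by rewrite Qs.
pose rep s := odflt 0 [pick r | sel r == s].
have repP r : sel (rep (sel r)) = sel r.
  rewrite /rep; case: pickP => [r' /eqP//|/(_ r)].
  by rewrite eqxx.
rewrite -cardsX -cardsT.
rewrite -(@card_imset _ _ (fun r => (sel r, r - rep (sel r)))).
  apply/subset_leq_card/subsetP=> _ /imsetP[r _ ->]; rewrite inE /=.
  have /andP[Ms /imsetP[p Pp Ep]] := selP r.
  have /andP[_ /imsetP[q Pq Eq]] := selP (rep (sel r)); rewrite repP in Eq.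
  rewrite Ms /=; set r' := rep _ in Eq *.
  have Prr : (r - r') - (p - q) \in P.
    apply: annt; rewrite !scalerBl.
    have -> : p *: t - q *: t = r *: t - r' *: t.
      by rewrite -Ep -Eq opprB addrA subrK.
    exact: subrr.
  rewrite -[r - r'](subrK (p - q)) -[X in _ + X]opprK.
  by apply: annihB => //; rewrite opprB; apply: annihB.
by move=> r r' [E]; rewrite E => /addIr.
Qed.

(** Intersect a complement of [U] in the socle with [S]; the modular law gives the decomposition. *)
Lemma simple_complement S U : is_submod S -> S \subset soc A ->
    is_simple_submod U -> U \subset S ->
  exists T, [/\ is_submod T, T \subset S, (#|T| < #|S|)%N,
                forall a, a \in U -> a \in T -> a = 0 & S = sumset T U].
Proof.
move=> Scl Ssoc Usimple US; have Ucl := simple_submod Usimple.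
have [N [Ncl UN socUN]] := complement_in_soc Ucl.
have disj a : a \in U -> a \in N :&: S -> a = 0.
  by move=> Ua /setIP[Na _]; apply/set1P; rewrite -UN inE Ua.
exists (N :&: S); split=> //; first exact: is_submodI.
- exact: subsetIr.
- apply: proper_card; rewrite properE subsetIr; apply/subsetPn.
  have [u Uu u0] := simple_neq0 Usimple.
  exists u; first exact: (subsetP US).
  by apply: contra u0 => /disj->.
apply/eqP; rewrite eqEsubset [X in _ && X]sumset_sub ?subsetIr // andbT.
apply/subsetP=> s Ss.
have /sumsetP[u [n [Uu Nn E]]] := subsetP socUN s (subsetP Ssoc s Ss).
apply/sumsetP; exists n, u; rewrite addrC -E Uu; split=> //.
by rewrite inE Nn -(addKr u n) -E addrC submodB // (subsetP US).
Qed.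

(** The torsion of [S] contains [U] besides the torsion of [T], which makes the bound strict for
    [T]. *)
Lemma small_torsion_lt S T U : is_simple_submod U -> is_submod T ->
    S = sumset T U -> (forall a, a \in U -> a \in T -> a = 0) ->
    small_torsion S ->
  (#|torsion (annih U) T| * #|annih U| < #|R|)%N.
Proof.
move=> Usimple Tcl defS disj Ssmall; have Ucl := simple_submod Usimple.
apply: leq_trans (Ssmall U Usimple).
have P0: (0 < #|annih U|)%N.
  by apply/card_gt0P; exists 0; case: (annih_left_ideal U).
rewrite ltn_pmul2r //; set M := torsion _ T.
have [u Uu u0] := simple_neq0 Usimple.
apply: proper_card; rewrite properE; apply/andP; split.
  apply/subsetP=> a /torsionP[Ta Pa]; apply/torsionP; split=> //.
  by rewrite defS (subsetP (sumsetSl T Ucl)).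
apply/subsetPn; exists u.
  apply/torsionP; split=> [|p /annihP]; last exact.
  by rewrite defS (subsetP (sumsetSr U Tcl)).
by apply: contra u0 => /torsionP[Tu _]; rewrite (disj u).
Qed.

(** Induction on [#|S|]: split off a simple [U] and adjust a generator [t] of the complement [T] by
    an element of [U]. *)
Lemma small_torsion_cyclic S : is_submod S -> S \subset soc A ->
  small_torsion S -> cyclic_submod S.
Proof.
have [n] := ubnP #|S|; elim: n S => // n IH S ltSn Scl Ssoc Ssmall.
have [/forall_inP S0 | /forall_inPn[a Sa a0]] := boolP [forall a in S, a == 0].
  apply: (cyclic_submodE Scl (submod0 Scl)) => s /S0/eqP->.
  by exists 0; rewrite scaler0.
have [U Usimple US] := contains_simple Scl Sa a0.
have [T [Tcl TS ltTS disj defS]] := simple_complement Scl Ssoc Usimple US.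
have [||t Tt defT] := IH T (leq_trans ltTS ltSn) Tcl.
- exact: subset_trans TS Ssoc.
- exact: small_torsionS TS Ssmall.
have := small_torsion_lt Usimple Tcl defS disj Ssmall.
(* The strict bound for [T] contradicts [card_torsion_cyclic] unless some [r] kills [t] but not
   [U]. *)
have [/forall_inP annt | /forall_inPn[r /eqP rt0]] :=
    boolP [forall r in [pred r | r *: t == 0], r \in annih U].
  rewrite ltnNge (card_torsion_cyclic Usimple Tcl (subset_trans TS Ssoc) Tt) //.
  move=> r rt0.
  by apply: annt; rewrite inE rt0.
rewrite inE => /forall_inPn[u Uu ru0] _.
have Su := subsetP US u Uu; have St := subsetP TS t Tt.
(* Since [r *: (t + u) = r *: u] is nonzero, the multiples of [t + u] contain [U], hence [t], hence
   all of [S]. *)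
pose N := multiples setT (t + u).
have Ncl : is_submod N.
  by apply: is_submod_multiples; split=> [|? ? ? ? ?]; rewrite inE.
have UN : U \subset N.
  apply: (simple_subZ (r := r) (u := u)) => //.
  by apply/imsetP; exists r; rewrite ?inE // scalerDr rt0 add0r.
have Ntu : t + u \in N by apply/imsetP; exists 1; rewrite ?scale1r ?inE.
have Nt : t \in N by rewrite -[t](addrK u) submodB // (subsetP UN).
have SN : S \subset N.
  rewrite defS sumset_sub // defT; apply/subsetP=> _ /imsetP[x _ ->].
  exact: submodZ.
apply: (cyclic_submodE Scl (submodD Scl St Su)) => s /(subsetP SN).
by case/imsetP=> x _ ->; exists x.
Qed.

End Submodules.

(** * Generating characters and the torsion bound *)

Section GeneratingCharacters.
Variables (R : finNzRingType) (A : finLmodType R).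
Implicit Types (S T U : {set A}) (chi : A -> algC).

(** Every nonzero submodule contains a nonzero cyclic one, so only the submodules R s are tested.
    The character is defined on all of [A] even when it is generating only for [S]. *)
Definition generating_char S chi : Prop :=
  additive_char chi
  /\ {in S, forall s, (forall r : R, chi (r *: s) = 1) -> s = 0}.

Lemma additive_char_scale chi (s : A) :
  additive_char chi -> additive_char (fun r : R => chi (r *: s)).
Proof.
move=> chi_char; apply: (@additive_char_comp _ _ (fun r : R => r *: s)) => //.
  exact: scale0r.
by move=> x y; rewrite scalerDl.
Qed.

Lemma additive_char_inj chi (a b : A) :
  additive_char chi -> chi a = chi b -> chi (a - b) = 1.
Proof.
move=> chi_char E; rewrite chi_char.2 E mulrC.
exact: (additive_charN b chi_char).
Qed.

(** Sending [s] to the character [r |-> chi (r *: s)] of R is injective on [S], and takes torsion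
    elements to characters trivial on P, of which there are |R / P|. *)
Lemma generating_small_torsion S chi :
  is_submod S -> generating_char S chi -> small_torsion S.
Proof.
move=> Scl [chi_char chi_gen] U Usimple; have Ucl := simple_submod Usimple.
rewrite -(card_irr_annihilator (annih_zmod U)) leq_mul2r; apply/orP; right.
pose sel s := odflt 0
  [pick i | [forall r : R, 'chi[[set: R]]_i r == chi (r *: s)]].
have selP s r : 'chi[[set: R]]_(sel s) r = chi (r *: s).
  rewrite /sel; case: pickP => [i /forallP/(_ r)/eqP // | noi].
  have [i Ei] := additive_char_irr (additive_char_scale s chi_char).
  by case/forallP: (negbT (noi i)) => x; rewrite Ei.
rewrite -(@card_in_imset _ _ sel) => [|s s' Ms Ms' E].
  apply/subset_leq_card/subsetP=> _ /imsetP[s /torsionP[Ss Ps] ->].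
  rewrite inE; apply/forall_inP=> p Pp.
  by rewrite selP Ps // chi_char.1.
have [Ss _] := torsionP _ _ _ Ms; have [Ss' _] := torsionP _ _ _ Ms'.
apply/eqP; rewrite -subr_eq0; apply/eqP/chi_gen => [|r].
  exact: submodB.
by rewrite scalerBr; apply: additive_char_inj; rewrite // -!selP E.
Qed.

(** Let [N] be the set of [r] with [chi] trivial on r T. If [N] lay in P = [annih U], each character
    of R trivial on P would be trivial on [N], hence equal to [r |-> chi (r *: s)] for some [s] in
    [T]. Such an [s] is killed by P, so the torsion would have at least |R / P| elements. *)
Lemma annih_char_not_sub T U chi : is_submod T -> is_submod U ->
    generating_char T chi -> (#|torsion (annih U) T| * #|annih U| < #|R|)%N ->
  exists r : R, {in T, forall s, chi (r *: s) = 1} /\ r \notin annih U.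
Proof.
move=> Tcl Ucl [chi_char chi_gen] lt.
pose N := [set r : R | [forall s in T, chi (r *: s) == 1]].
have NP r : reflect {in T, forall s, chi (r *: s) = 1} (r \in N).
  rewrite inE; apply: (iffP forall_inP) => [H s /H/eqP // | H s /H ->//].
have [/subsetP NU | /subsetPn[r /NP Nr Ur]] := boolP (N \subset annih U);
  last by exists r.
case/negP: (negbT (ltn_geF lt)).
rewrite -(card_irr_annihilator (annih_zmod U)) leq_mul2r; apply/orP; right.
have Ncl : zmod_closed N.
  split=> [|r r' /NP Nr /NP Nr']; apply/NP=> s Ts.
    by rewrite scale0r chi_char.1.
  by rewrite scalerBl; apply: additive_char_inj; rewrite // Nr ?Nr'.
have T0 : #|T|%:R != 0 :> algC.
  by rewrite pnatr_eq0 -lt0n; apply/card_gt0P; exists 0; apply: submod0.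
pose sel i := odflt 0
  [pick s in T | [forall r : R, 'chi[[set: R]]_i r == chi (r *: s)]].
have selP i : i \in irr_annihilator (annih U) ->
    sel i \in T /\ forall r, 'chi[[set: R]]_i r = chi (r *: sel i).
  rewrite inE => /forall_inP triv; rewrite /sel; case: pickP => [s|nos].
    by case/andP=> Ts /forallP E; split=> // r; apply/eqP.
  have [||||s Ts E] := @char_in_family _ _ (mem T)
      (fun s r => chi (r *: s)) N _ (fun r : R => 'chi[[set: R]]_i r) _ T0 Ncl.
  - by move=> s _; apply: additive_char_scale.
  - move=> r; have [D0 DD] := chi_char.
    rewrite (@sum_char_subgroup _ T (fun s => chi (r *: s))) ?inE //.
    + exact: submod_zmod.
    + by rewrite scaler0.
    by move=> s s' _ _; rewrite /= scalerDr DD.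
  - exact: irr_additive_char.
  - by move=> r /NU/triv/eqP.
  by have := nos s; rewrite [_ \in _]Ts /=; case/forallP=> r; rewrite E.
rewrite -(@card_in_imset _ _ sel) => [|i j /selP[_ Ei] /selP[_ Ej] E].
  apply/subset_leq_card/subsetP=> _ /imsetP[i ann_i ->].
  have [Ts Es] := selP i ann_i; apply/torsionP; split=> // p Pp.
  apply: chi_gen => [|r]; first exact: submodZ.
  rewrite scalerA -Es; move: ann_i; rewrite inE => /forall_inP triv.
  apply/eqP/triv; case: (annih_left_ideal U) => P0 /(_ r p 0 Pp P0).
  by rewrite addr0.
apply: irr_inj; apply/cfunP=> r.
by rewrite Ei Ej E.
Qed.

(** The same induction as for cyclicity: a generating character of [T] is modified outside [T] so as
    to detect [U] as well. *)
Lemma small_torsion_generating S : is_submod S -> S \subset soc A ->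
  small_torsion S -> exists chi, generating_char S chi.
Proof.
have [n] := ubnP #|S|; elim: n S => // n IH S ltSn Scl Ssoc Ssmall.
have [/forall_inP S0 | /forall_inPn[a Sa a0]] := boolP [forall a in S, a == 0].
  exists (fun=> 1); split; first by split=> // x y; rewrite mulr1.
  by move=> s /S0/eqP.
have [U Usimple US] := contains_simple Scl Sa a0.
have Ucl := simple_submod Usimple.
have [T [Tcl TS ltTS disj defS]] := simple_complement Scl Ssoc Usimple US.
have [||chi chi_gen] := IH T (leq_trans ltTS ltSn) Tcl.
- exact: subset_trans TS Ssoc.
- exact: small_torsionS TS Ssmall.
have ltR := small_torsion_lt Usimple Tcl defS disj Ssmall.
have [r [Tr]] := annih_char_not_sub Tcl Ucl chi_gen ltR.
rewrite inE => /forall_inPn[u Uu ru0].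
(* If [chi] does not see [r *: u], multiply it by a character that is trivial on [T] but not at
   [r *: u]. *)
have [theta [theta_char thetaT theta_ru]] : exists theta,
    [/\ additive_char theta, {in T, theta =1 chi} & theta (r *: u) != 1].
  have [chi_char _] := chi_gen.
  have [chi1|] := eqVneq (chi (r *: u)) 1; last by exists chi.
  have Tru : r *: u \notin T.
    by apply: contra ru0 => /disj-> //; apply: submodZ.
  have [i triv ne1] := irr_separates (submod_zmod Tcl) Tru.
  exists (fun x => chi x * 'chi[[set: A]]_i x); split.
  - by apply: additive_char_mul => //; apply: irr_additive_char.
  - by move=> t Tt; rewrite /= triv ?mulr1.
  by rewrite chi1 mul1r.
exists theta; split=> // s Ss triv; move: Ss triv; rewrite defS.
case/sumsetP=> t [v [Tt Uv ->]].
have [-> | v0] := eqVneq v 0.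
  rewrite addr0 => triv; apply: chi_gen.2 => // x.
  by rewrite -thetaT ?submodZ.
pose N := multiples [set: R] v.
have Ncl : is_submod N.
  by apply: is_submod_multiples; split=> [|? ? ? ? ?]; rewrite inE.
have /subsetP/(_ u Uu)/imsetP[x _ ux] : U \subset N.
  apply: simple_sub Uv _ v0 => //.
  by apply/imsetP; exists 1; rewrite ?scale1r ?inE.
(* With [x *: v = u], the scalar [r * x] isolates [theta (r *: u)], because [theta] is trivial on r
   T. *)
move=> /(_ (r * x)); rewrite scalerDr theta_char.2 -!scalerA -ux.
rewrite thetaT ?submodZ // Tr ?submodZ // mul1r => E.
by rewrite E eqxx in theta_ru.
Qed.

(** A nonzero R s contains a simple submodule, which lies in the socle. *)
Lemma generating_soc chi :
  generating_char (soc A) chi -> generating_char [set: A] chi.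
Proof.
case=> chi_char chi_gen; split=> // s _ triv; apply: contraTeq isT => s0.
pose N := multiples [set: R] s.
have Ncl : is_submod N.
  by apply: is_submod_multiples; split=> [|? ? ? ? ?]; rewrite inE.
have Ns : s \in N by apply/imsetP; exists 1; rewrite ?scale1r ?inE.
have [U Usimple /subsetP UN] := contains_simple Ncl Ns s0.
have [u Uu /eqP[]] := simple_neq0 Usimple.
apply: chi_gen => [|r]; first exact: (subsetP (simple_sub_soc Usimple)).
by have /imsetP[x _ ->] := UN u Uu; rewrite scalerA.
Qed.

Theorem cyclic_soc_generating :
  cyclic_submod (soc A) <-> exists chi, generating_char [set: A] chi.
Proof.
have socCl := @is_submod_soc R A; split=> [socC | [chi [chi_char chi_gen]]].
  have [|chi /generating_soc] := small_torsion_generating socCl (subxx _).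
    exact: cyclic_small_torsion.
  by exists chi.
apply: small_torsion_cyclic => //.
apply: (@generating_small_torsion _ chi) => //.
by split=> // s _; apply: chi_gen; rewrite inE.
Qed.

End GeneratingCharacters.

(** * From a generating character to the extension property *)

Section GeneratingImpliesExtension.
Variables (R : finNzRingType) (A : finLmodType R) (G : {group {perm A}}).
Hypothesis linG : G \subset autR A.
Variables (chi : A -> algC) (chi_gen : generating_char [set: A] chi).

Section Source.
Variables (V : finLmodType R) (C : {set V}).
Hypothesis Ccl : submod_closed C.
Implicit Types (phi psi nu : V -> A) (s t : {perm A}).

Definition linear_on phi : Prop :=
  forall r : R, {in C &, forall x y, phi (r *: x + y) = r *: phi x + phi y}.

(* Zero outside C, so that twists are equal iff they agree on C. *)
Definition twist phi t : {ffun V -> A} :=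
  [ffun x => if x \in C then t (phi x) else 0].

Definition twists phi : {set {ffun V -> A}} := [set twist phi t | t in G].

(** The elements of [G] carrying [phi] to [psi] on [C]; [twist psi 1%g] is [psi] cut off outside
    [C]. *)
Definition movers phi psi : {set {perm A}} :=
  [set t in G | twist phi t == twist psi 1%g].

Lemma twistP phi psi s t :
  reflect {in C, forall x, s (phi x) = t (psi x)} (twist phi s == twist psi t).
Proof.
apply: (iffP eqP) => [/ffunP E x Cx|E]; first by have := E x; rewrite !ffunE Cx.
by apply/ffunP=> x; rewrite !ffunE; case: ifP => // /E.
Qed.

Lemma moversP phi psi t :
  reflect (t \in G /\ {in C, forall x, t (phi x) = psi x})
    (t \in movers phi psi).
Proof.
rewrite inE; apply: (iffP andP) => -[Gt E]; split=> //.
  by move: E => /twistP E x Cx; rewrite E // perm1.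
by apply/twistP=> x Cx; rewrite E // perm1.
Qed.

Lemma twists_eqP phi psi :
  reflect (exists t, t \in movers phi psi) (twists phi == twists psi).
Proof.
apply: (iffP eqP) => [E|[t /moversP[Gt Et]]].
  have: twist psi 1%g \in twists phi by rewrite E imset_f.
  by case/imsetP=> t Gt Et; exists t; rewrite inE Gt Et eqxx.
apply/setP=> h; apply/imsetP/imsetP => -[s Gs ->].
  exists (t^-1 * s)%g; first by rewrite groupM ?groupV.
  by apply/eqP/twistP=> x Cx; rewrite permM -Et // permK.
exists (t * s)%g; first by rewrite groupM.
by apply/eqP/twistP=> x Cx; rewrite permM Et.
Qed.

(** When nonempty, the movers form a coset of the stabiliser [movers psi psi]. *)
Lemma card_movers phi psi :
  #|movers phi psi| = ((twists phi == twists psi) * #|movers psi psi|)%N.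
Proof.
have [/twists_eqP[t /moversP[Gt Et]] | noeq] := boolP (_ == _); last first.
  apply/eqP; rewrite mul0n cards_eq0; apply: contraR noeq => /set0Pn[t mt].
  by apply/twists_eqP; exists t.
rewrite mul1n -(card_imset (mem (movers psi psi)) (mulgI t)).
apply: eq_card => s.
apply/moversP/imsetP => [[Gs Es]|[s' /moversP[Gs' Es'] ->]].
  exists (t^-1 * s)%g; last by rewrite mulKVg.
  apply/moversP; split=> [|x Cx]; first by rewrite groupM ?groupV.
  by rewrite permM -{1}Et // permK Es.
by split=> [|x Cx]; rewrite ?groupM // permM Et ?Es'.
Qed.

Lemma linear_on_twist phi t : t \in G -> linear_on phi ->
  linear_on (fun x => t (phi x)).
Proof.
move=> Gt lin r x y Cx Cy; have /autRP lint := subsetP linG t Gt.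
by rewrite lin // lint.
Qed.

Lemma linear_onB phi psi : linear_on phi -> linear_on psi ->
  linear_on (fun x => phi x - psi x).
Proof.
move=> lin lin' r x y Cx Cy.
by rewrite lin // lin' // scalerBr opprD addrACA.
Qed.

(** The image of [C] under [phi] is a submodule, so [chi] is trivial on it only if it is zero. *)
Lemma sum_char_linear_on phi : linear_on phi ->
  \sum_(x in C) chi (phi x) = #|C|%:R *+ [forall x in C, phi x == 0].
Proof.
move=> lin; have [chi_char chi0] := chi_gen; have [C0 ClinC] := Ccl.
have phi0 : phi 0 = 0.
  have := lin 1 0 0 C0 C0; rewrite !scale1r addr0 => E.
  by apply: (addrI (phi 0)); rewrite -E addr0.
have Czmod : zmod_closed C.
  by split=> // x y Cx Cy; rewrite -scaleN1r addrC ClinC.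
have chiD : {in C &, {morph (fun x => chi (phi x)) : x y / x + y >-> x * y}}.
  move=> x y Cx Cy; rewrite -chi_char.2; congr (chi _).
  by have := lin 1 x y Cx Cy; rewrite !scale1r.
rewrite (sum_char_subgroup Czmod _ chiD); last by rewrite phi0 chi_char.1.
congr (_ *+ nat_of_bool _); apply/forall_inP/forall_inP => triv x Cx;
  last first.
  by rewrite (eqP (triv x Cx)) chi_char.1.
apply/eqP/chi0 => [|r]; first by rewrite inE.
have Crx : r *: x \in C by rewrite -[_ *: _]addr0 ClinC.
by have /eqP := triv _ Crx; rewrite -[r *: x]addr0 lin // phi0 addr0.
Qed.

Section Families.
Variables (n : nat) (u v : 'I_n -> V -> A).
Hypotheses (u_lin : forall i, linear_on (u i))
           (v_lin : forall i, linear_on (v i)).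
Hypothesis sum_uv : {in C, forall x,
  \sum_i \sum_(t in G) chi (t (u i x)) = \sum_i \sum_(t in G) chi (t (v i x))}.

(** Orthogonality on [C]: the sum of [chi (t (w i x) - nu x)] over [C] is [#|C|] or 0 according as
    [t] moves [w i] to [nu] or not. Hence the counts depend only on the double sum of characters
    that [u] and [v] share. *)
Lemma sum_card_movers (w : 'I_n -> V -> A) nu :
    (forall i, linear_on (w i)) -> linear_on nu ->
  (\sum_i #|movers (w i) nu|)%:R * #|C|%:R =
  \sum_(x in C) chi (- nu x) * \sum_i \sum_(t in G) chi (t (w i x)).
Proof.
move=> w_lin nu_lin; have [chi_char _] := chi_gen.
under [RHS]eq_bigr => x Cx do rewrite big_distrr /=.
rewrite exchange_big /= natr_sum big_distrl /=; apply: eq_bigr => i _.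
under [RHS]eq_bigr => x Cx do rewrite big_distrr /=.
rewrite exchange_big /= -sum1_card natr_sum big_distrl /=.
rewrite [LHS]big_mkcond [RHS]big_mkcond; apply: eq_bigr => t _.
rewrite mul1r; case: ifP => [tm|]; case: ifP => Gt.
- transitivity (\sum_(x in C) chi (t (w i x) - nu x)).
    rewrite sum_char_linear_on; last exact/linear_onB/nu_lin/linear_on_twist.
    have /moversP[_ E] := tm.
    by case: forall_inP => // -[] x Cx; rewrite E // subrr.
  by apply: eq_bigr => x _; rewrite chi_char.2 mulrC.
- by case/moversP: tm; rewrite Gt.
- move=> tm; transitivity (\sum_(x in C) chi (t (w i x) - nu x)).
    rewrite sum_char_linear_on; last exact/linear_onB/nu_lin/linear_on_twist.
    case: forall_inP => // E; case/moversP: tm; split=> // x /E.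
    by rewrite subr_eq0 => /eqP.
  by apply: eq_bigr => x _; rewrite chi_char.2 mulrC.
- by [].
Qed.

Lemma card_twists_eq nu : linear_on nu ->
  #|[set i | twists (u i) == twists nu]| =
  #|[set i | twists (v i) == twists nu]|.
Proof.
move=> nu_lin.
have C0 : #|C|%:R != 0 :> algC.
  by rewrite pnatr_eq0 -lt0n; apply/card_gt0P; exists 0; case: Ccl.
have /eqP : (\sum_i #|movers (u i) nu|)%:R * #|C|%:R =
    (\sum_i #|movers (v i) nu|)%:R * #|C|%:R :> algC.
  rewrite !sum_card_movers //; apply: eq_bigr => x Cx; congr (_ * _).
  exact: sum_uv.
rewrite -subr_eq0 -mulrBl mulf_eq0 (negPf C0) orbF subr_eq0 eqr_nat.
have cardE (w : 'I_n -> V -> A) : (\sum_i #|movers (w i) nu| =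
    #|[set i | twists (w i) == twists nu]| * #|movers nu nu|)%N.
  under eq_bigr => i _ do rewrite card_movers.
  rewrite -big_distrl /=; congr (_ * _)%N.
  rewrite -sum1dep_card [RHS]big_mkcond.
  by apply: eq_bigr => i _; case: eqP.
rewrite !cardE eqn_pmul2r => [/eqP//|].
by apply/card_gt0P; exists 1%g; apply/moversP; split=> // x _; rewrite perm1.
Qed.

Lemma matching_of_families : exists (sigma : 'S_n) (tau : 'I_n -> {perm A}),
  forall i, tau i \in G /\ {in C, forall x, tau i (u (sigma i) x) = v i x}.
Proof.
have countE (w : 'I_n -> V -> A) L :
    count_mem L [tuple twists (w i) | i < n] = #|[set i | twists (w i) == L]|.
  rewrite /= count_map cardsE cardE size_filter /= enumT.
  by apply: eq_count => i; rewrite /= unfold_in.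
(* Multiplicities are compared only at orbits that occur, and these are orbits of linear maps, as
   [card_twists_eq] requires. *)
have: perm_eq [tuple twists (v i) | i < n] [tuple twists (u i) | i < n].
  apply/allP=> L; rewrite mem_cat /= !countE => /orP[]/mapP[i _ ->].
    by rewrite card_twists_eq.
  by rewrite card_twists_eq.
case/tuple_permP=> sigma E.
have mv i : exists t, t \in movers (u (sigma i)) (v i).
  apply/twists_eqP.
  have := congr1 (fun L : seq {set {ffun V -> A}} => nth set0 L i) E.
  by rewrite -!tnth_nth !tnth_mktuple => ->.
exists sigma, (fun i => odflt 1%g [pick t in movers (u (sigma i)) (v i)]) => i.
case: pickP => [t /moversP//|no]; have [t mt] := mv i.
by rewrite no in mt.
Qed.

End Families.
End Source.

(** The inner sum over [G] is constant on orbits, so the total depends only on the number of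
    components in each orbit. *)
Lemma sum_orbit_swc n (x y : {ffun 'I_n -> A}) :
    {in orbits G, forall O, swc y O = swc x O} ->
  \sum_i \sum_(t in G) chi (t (x i)) = \sum_i \sum_(t in G) chi (t (y i)).
Proof.
move=> Exy; pose Psi a := \sum_(t in G) chi (t a).
pose Psi1 (O : {set A}) := if [pick a in O] is Some a then Psi a else 0.
have PsiE a : Psi a = Psi1 (orbit 'P G a).
  rewrite /Psi1; case: pickP => [b /imsetP[t Gt ->] | /(_ a)].
    rewrite /Psi (reindex_inj (mulgI t)) /=.
    by apply: eq_big => s; rewrite ?groupMl // permM.
  by rewrite orbit_refl.
have sumE (z : {ffun 'I_n -> A}) :
    \sum_i Psi (z i) = \sum_(O in orbits G) #|[set i | z i \in O]|%:R * Psi1 O.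
  rewrite (partition_big (fun i => orbit 'P G (z i)) (mem (orbits G))) /=;
    last by move=> i _; rewrite imset_f.
  apply: eq_bigr => O /imsetP[a _ ->].
  rewrite -sum1_card natr_sum big_distrl /=.
  apply: eq_big => [i|i /eqP <-]; last by rewrite mul1r PsiE.
  by rewrite inE orbit_eq_mem.
rewrite (sumE x) (sumE y); apply: eq_bigr => O orbO; congr (_ * _).
have /eqP := Exy O orbO; rewrite /swc eqr_nat => /eqP E.
by congr _%:R; symmetry; exact: E.
Qed.

Theorem generating_char_extension : extension_property A G.
Proof.
move=> n C1 C2 f C1cl C2cl [f_lin _ _] f_swc.
pose u i (x : {ffun 'I_n -> A}) := x i; pose v i x := f x i.
have [||| sigma [tau matching]] := @matching_of_families _ C1 C1cl n u v.
- by move=> i r x y _ _; rewrite /u !ffunE.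
- by move=> i r x y Cx Cy; rewrite /v f_lin // !ffunE.
- by move=> x Cx; apply: sum_orbit_swc => O; apply: f_swc.
exists (fun x => [ffun i => tau i (x (sigma i))]).
  by exists sigma, tau; split=> // i; case: (matching i).
move=> x Cx; apply/ffunP=> i; rewrite ffunE.
by case: (matching i) => _ /(_ x Cx).
Qed.

End GeneratingImpliesExtension.

(** * From the extension property to a generating character *)

Section ExtensionImpliesGenerating.
Variables (R : finNzRingType) (A : finLmodType R).

Section Pairing.
Variable I : finType.
Local Notation E := {ffun I -> A}.
Local Notation X := {ffun I -> R}.
Implicit Types (a b : E) (x y : X) (t : {perm A}).

Definition pair_sum x a : A := \sum_i x i *: a i.

Lemma pair_sumD x : {morph pair_sum x : a b / a + b}.
Proof.
move=> a b; rewrite -big_split; apply: eq_bigr => i _.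
by rewrite ffunE scalerDr.
Qed.

Lemma pair_sum0 x : pair_sum x 0 = 0.
Proof. by apply: big1 => i _; rewrite ffunE scaler0. Qed.

Lemma pair_sumB x : {morph pair_sum x : a b / a - b}.
Proof.
by move=> a b; apply: (addIr (pair_sum x b)); rewrite -pair_sumD !subrK.
Qed.

Lemma pair_sum_linear (r : R) x y a :
  pair_sum [ffun i => r * x i + y i] a = r *: pair_sum x a + pair_sum y a.
Proof.
rewrite scaler_sumr -big_split; apply: eq_bigr => i _.
by rewrite ffunE scalerDl scalerA.
Qed.

Definition single (i : I) (c : A) : E := [ffun j => if j == i then c else 0].

Lemma pair_sum_single x i c : pair_sum x (single i c) = x i *: c.
Proof.
rewrite /pair_sum (bigD1 i) //= ffunE eqxx big1 ?addr0 // => j /negPf ji.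
by rewrite ffunE ji scaler0.
Qed.

Lemma pair_sum_delta i a : pair_sum [ffun j => (j == i)%:R] a = a i.
Proof.
rewrite /pair_sum (bigD1 i) //= ffunE eqxx scale1r.
rewrite big1 ?addr0 // => j /negPf ji.
by rewrite ffunE ji scale0r.
Qed.

Definition pointwise t a : E := [ffun i => t (a i)].

Lemma linear0_perm t : linear t -> t 0 = 0.
Proof.
move=> lint; have := lint (-1) 0 0.
by rewrite scaler0 addr0 scaleN1r addNr.
Qed.

Lemma pair_sum_pointwise t x a : t \in autR A ->
  pair_sum x (pointwise t a) = t (pair_sum x a).
Proof.
move=> /autRP lint.
have t0 := linear0_perm lint.
have tD : {morph t : b c / b + c}.
  by move=> b c; rewrite -[b]scale1r lint !scale1r.
rewrite /pair_sum (big_morph t tD t0); apply: eq_bigr => i _.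
by rewrite ffunE -[x i *: a i]addr0 lint t0 addr0.
Qed.

Definition pair_ker x : {set E} := [set a | pair_sum x a == 0].

Lemma pair_ker_zmod x : zmod_closed (pair_ker x).
Proof.
split=> [|a b]; rewrite !inE ?pair_sum0 // => /eqP Ka /eqP Kb.
by rewrite pair_sumB Ka Kb subrr.
Qed.

(** The positive and negative parts of [h] have the same distribution of values under each
    [pair_sum x]; taking orbits for [B] will give equality of swc. *)
Definition balanced (h : E -> int) : Prop :=
  forall x (B : {set A}), \sum_(a | pair_sum x a \in B) h a = 0.

(** * An invariant nonzero balanced weight *)

Section Balancing.
Variables (G : {group {perm A}}) (theta : E -> algC).
Hypotheses (linG : G \subset autR A) (theta_char : additive_char theta).
Hypothesis theta_ker : forall x, exists2 a, a \in pair_ker x & theta a != 1.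

Definition coset_sum (h : E -> int) x a : int :=
  \sum_(k in pair_ker x) h (a - k).

(* Convolution of [h] with [|K|[0] - \sum_(k in K) [k]], K the kernel of x. *)
Definition balance x (h : E -> int) a : int :=
  h a *+ #|pair_ker x| - coset_sum h x a.

(** Over [enum X] this is the element eta of the group ring, built by successive convolution from
    the point mass at 0. *)
Definition balanced_weight (s : seq X) : E -> int :=
  foldr balance (fun a => (a == 0)%:R) s.

Definition fourier (h : E -> int) : algC := \sum_a (h a)%:~R * theta a.

(** Being nontrivial on the kernel, [theta] sums to 0 over it, so the convolving factor is sent to
    [#|pair_ker x|]. *)
Lemma fourier_balance x h : fourier (balance x h) = fourier h *+ #|pair_ker x|.
Proof.
have sumK : \sum_(k in pair_ker x) theta k = 0.
  rewrite (@sum_char_subgroup _ (pair_ker x) theta) //; first last.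
  - by move=> a b _ _; apply: theta_char.2.
  - by case: theta_char.
  - exact: pair_ker_zmod.
  have [a Ka a1] := theta_ker x.
  by case: forall_inP => // /(_ a Ka); rewrite (negPf a1).
have avg0 : \sum_a (coset_sum h x a)%:~R * theta a = 0.
  transitivity (\sum_(k in pair_ker x) \sum_a (h (a - k))%:~R * theta a).
    rewrite exchange_big; apply: eq_bigr => a _ /=.
    by rewrite rmorph_sum big_distrl.
  transitivity (\sum_(k in pair_ker x) theta k * fourier h).
    apply: eq_bigr => k _; rewrite (reindex_inj (addIr k)) /= big_distrr /=.
    apply: eq_bigr => a _; rewrite addrK theta_char.2.
    by rewrite mulrA mulrC.
  by rewrite -big_distrl /= sumK mul0r.
rewrite -[RHS]subr0 -{}avg0 /fourier -sumrMnl -sumrB; apply: eq_bigr => a _.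
by rewrite rmorphB rmorphMn /= mulrBl mulrnAl.
Qed.

Lemma fourier_balanced_weight s : fourier (balanced_weight s) != 0.
Proof.
elim: s => [|x s IH] /=.
  rewrite /fourier (bigD1 0) //= eqxx big1 ?addr0 => [|a /negPf ->].
    by rewrite theta_char.1 mulr1 oner_neq0.
  by rewrite mul0r.
rewrite fourier_balance -mulr_natr mulf_neq0 // pnatr_eq0 -lt0n.
by apply/card_gt0P; exists 0; case: (pair_ker_zmod x).
Qed.

Lemma pointwise_inj t : injective (pointwise t).
Proof.
move=> a b /ffunP E; apply/ffunP=> i; apply: (@perm_inj _ t).
by have := E i; rewrite !ffunE.
Qed.

Lemma pointwiseB t a b : t \in autR A ->
  pointwise t (a - b) = pointwise t a - pointwise t b.
Proof.
move=> /autRP lint; apply/ffunP=> i; rewrite !ffunE.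
by rewrite addrC -scaleN1r lint scaleN1r addrC.
Qed.

(** Acting by [t] maps each kernel onto itself, so every convolving factor is invariant. *)
Lemma balanced_weight_inv s t a : t \in G ->
  balanced_weight s (pointwise t a) = balanced_weight s a.
Proof.
move=> Gt; have lint := subsetP linG t Gt.
have pw0 b : (pointwise t b == 0) = (b == 0).
  have pt0 : pointwise t 0 = 0.
    by have := pointwiseB 0 0 lint; rewrite subrr => ->; rewrite subrr.
  by rewrite -{1}pt0 (inj_eq (@pointwise_inj t)).
elim: s a => [|x s IH] a /=; first by rewrite pw0.
rewrite /balance IH; congr (_ - _); rewrite /coset_sum.
rewrite (reindex_inj (@pointwise_inj t)) /=; apply: eq_big => [k|k _].
  have t0 c : (t c == 0) = (c == 0).
    by have /autRP/linear0_perm tt0 := lint; rewrite -{1}tt0 (inj_eq perm_inj).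
  by rewrite !inE pair_sum_pointwise // t0.
by rewrite -pointwiseB.
Qed.

Lemma coset_sum_balance x y h a :
  coset_sum (balance x h) y a =
  coset_sum h y a *+ #|pair_ker x|
  - \sum_(k in pair_ker x) coset_sum h y (a - k).
Proof.
rewrite /coset_sum /balance sumrB sumrMnl; congr (_ - _).
rewrite exchange_big; apply: eq_bigr => k _; apply: eq_bigr => l _.
by rewrite addrAC.
Qed.

Lemma coset_sum_shift h x a k :
  k \in pair_ker x -> coset_sum h x (a - k) = coset_sum h x a.
Proof.
move=> Kk; rewrite /coset_sum [RHS](reindex_inj (addIr k)) /=.
apply: eq_big => [l|l _]; last by rewrite opprD addrA addrAC.
by move: Kk; rewrite !inE pair_sumD => /eqP ->; rewrite addr0.
Qed.

(** The factor for [x] kills the sums over cosets of its own kernel, and convolution with the other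
    factors preserves this vanishing. *)
Lemma coset_sum_balanced_weight s x a :
  x \in s -> coset_sum (balanced_weight s) x a = 0.
Proof.
elim: s a => // y s IH a; rewrite inE => /orP[/eqP <-|xs] /=;
  rewrite coset_sum_balance.
  under eq_bigr => k Kk do rewrite coset_sum_shift //.
  by rewrite sumr_const subrr.
by rewrite IH // mul0rn sub0r big1 ?oppr0 // => k _; rewrite IH.
Qed.

Lemma balanced_weight_balanced : balanced (balanced_weight (enum X)).
Proof.
move=> x B; rewrite (partition_big (pair_sum x) (mem B)) //=.
apply: big1 => c Bc; set h := balanced_weight _.
have [/existsP[a0 /eqP Ea0] | /existsPn no] :=
    boolP [exists a, pair_sum x a == c]; last first.
  by apply: big1 => a /andP[_]; rewrite (negPf (no a)).
rewrite -[RHS](coset_sum_balanced_weight a0 (mem_enum _ x)) /coset_sum -/h.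
(* A nonempty fibre of [pair_sum x] is the coset of the kernel through [a0]. *)
rewrite (reindex_inj (subrI a0)) /=; apply: eq_bigl => k.
rewrite inE pair_sumB Ea0 [X in _ && X]eq_sym.
rewrite -subr_eq0 opprB addrCA subrr addr0.
by case: eqP => [->|]; rewrite ?subr0 ?Bc ?andbF.
Qed.

Lemma exists_balanced : exists h : E -> int,
  [/\ balanced h, {in G, forall t a, h (pointwise t a) = h a}
    & exists a, h a != 0].
Proof.
exists (balanced_weight (enum X)); split.
- exact: balanced_weight_balanced.
- by move=> t Gt a; apply: balanced_weight_inv.
apply/existsP; apply: contraNT (fourier_balanced_weight (enum X)).
move=> /existsPn h0; rewrite /fourier big1 // => a _.
by have := h0 a; rewrite negbK => /eqP ->; rewrite mul0r.
Qed.

End Balancing.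

(** * The two codes built from a balanced weight *)

Section Codes.
Variables (G : {group {perm A}}) (h : E -> int).
Hypotheses (linG : G \subset autR A) (h_bal : balanced h).
Hypothesis h_inv : {in G, forall t a, h (pointwise t a) = h a}.

(** The negative part of [h] for [e = true], the positive part for [e = false]. *)
Definition mult (e : bool) a : nat := if (h a < 0) == e then `|h a|%N else 0%N.

Definition columns e : seq E := flatten [seq nseq (mult e a) a | a <- enum E].

Lemma mem_columns e a : (a \in columns e) = ((h a != 0) && ((h a < 0) == e)).
Proof.
apply/flatten_mapP/andP => [[b _] | [ha he]].
  rewrite mem_nseq /mult => /andP[lt /eqP ->]; move: lt.
  by case: ifP => //; rewrite absz_gt0.
by exists a; rewrite ?mem_enum // mem_nseq /mult he absz_gt0 ha eqxx.
Qed.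

Lemma count_columns e (P : pred E) :
  count P (columns e) = (\sum_(a | P a) mult e a)%N.
Proof.
rewrite count_flatten sumnE big_map big_map big_enum [RHS]big_mkcond /=.
by apply: eq_bigr => a _; rewrite count_nseq; case: (P a); rewrite ?mul1n.
Qed.

Lemma count_columns_eq x (B : {set A}) :
  count (fun a => pair_sum x a \in B) (columns true) =
  count (fun a => pair_sum x a \in B) (columns false).
Proof.
rewrite !count_columns; apply/eqP; rewrite -eqz_nat -subr_eq0.
rewrite !(big_morph Posz PoszD (erefl 0%:Z)) -sumrB -oppr_eq0 -sumrN.
rewrite -[X in _ == X](h_bal x B).
apply/eqP/eq_bigr => a _; rewrite opprB /mult.
case: ltrP => ha /=; rewrite ?subr0 ?sub0r abszE.
  by rewrite ltr0_norm ?opprK.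
by rewrite ger0_norm.
Qed.

Lemma size_columns : size (columns true) = size (columns false).
Proof.
have := count_columns_eq 0 setT.
rewrite (eq_count (a2 := predT)) => [|a]; last by rewrite inE.
rewrite [RHS](eq_count (a2 := predT)) => [|a]; last by rewrite inE.
by rewrite !count_predT.
Qed.

Let n := size (columns true).

Lemma size_columns_n e : size (columns e) = n.
Proof. by case: e; rewrite /n ?size_columns. Qed.

Definition column e (i : 'I_n) : E := nth 0 (columns e) i.

Lemma mem_column e i : column e i \in columns e.
Proof. by rewrite mem_nth // size_columns_n. Qed.

Definition encode e x : {ffun 'I_n -> A} := [ffun i => pair_sum x (column e i)].

Definition code e : {set {ffun 'I_n -> A}} := [set encode e x | x : X].

Lemma encode_linear e (r : R) x y :
  encode e [ffun i => r * x i + y i] = r *: encode e x + encode e y.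
Proof. by apply/ffunP=> i; rewrite !ffunE pair_sum_linear. Qed.

Lemma card_encode e x (B : {set A}) :
  #|[set i | encode e x i \in B]| =
  count (fun a => pair_sum x a \in B) (columns e).
Proof.
rewrite -[columns e](mkseq_nth 0) size_columns_n /mkseq -val_enum_ord -map_comp.
rewrite count_map cardsE cardE size_filter -enumT.
by apply: eq_count => i; transitivity (encode e x i \in B) => //; rewrite ffunE.
Qed.

(** Balance at the complement of 0 shows that both encodings of [x] have the same number of nonzero
    components. This makes [recode] well defined and injective on the code. *)
Lemma encode_eq0 d e x : encode d x = 0 -> encode e x = 0.
Proof.
have card0 c :
    (encode c x == 0) = (#|[set i | encode c x i \in [set~ 0]]| == 0%N).
  rewrite cards_eq0; apply/eqP/eqP => [-> | /setP E].
    by apply/setP=> i; rewrite !inE ffunE eqxx.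
  apply/ffunP=> i; rewrite [RHS]ffunE; apply/eqP.
  by have := E i; rewrite !inE => /negbFE.
have eq0 c : (encode c x == 0) = (encode true x == 0).
  by case: c => //; rewrite !card0 !card_encode count_columns_eq.
by move=> /eqP; rewrite eq0 -(eq0 e) => /eqP.
Qed.

Lemma encode_eq d e x y : encode d x = encode d y -> encode e x = encode e y.
Proof.
move=> E.
have diff c : encode c [ffun i => -1 * y i + x i] = encode c x - encode c y.
  by rewrite encode_linear scaleN1r addrC.
by apply/eqP; rewrite -subr_eq0 -diff (encode_eq0 (d := d)) // diff E subrr.
Qed.

Definition recode (z : {ffun 'I_n -> A}) : {ffun 'I_n -> A} :=
  if [pick x | encode true x == z] is Some x then encode false x else 0.

Lemma recodeE x : recode (encode true x) = encode false x.
Proof.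
rewrite /recode; case: pickP => [y /eqP E | /(_ x)]; last by rewrite eqxx.
exact: encode_eq E.
Qed.

Lemma linear_code_code e : linear_code (code e).
Proof.
split=> [|r _ _ /imsetP[x _ ->] /imsetP[y _ ->]]; apply/imsetP.
  exists 0 => //; apply/ffunP=> i; rewrite !ffunE /pair_sum big1 // => j _.
  by rewrite ffunE scale0r.
by exists [ffun i => r * x i + y i]; rewrite ?encode_linear.
Qed.

Lemma recode_isom : linear_isom (code true) (code false) recode.
Proof.
split.
- move=> r _ _ /imsetP[x _ ->] /imsetP[y _ ->].
  by rewrite -encode_linear !recodeE encode_linear.
- move=> _ _ /imsetP[x _ ->] /imsetP[y _ ->]; rewrite !recodeE.
  by move=> E; apply: encode_eq E.
apply/setP=> z; apply/imsetP/imsetP => [[_ /imsetP[x _ ->] ->]|[x _ ->]].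
  by exists x; rewrite ?recodeE.
by exists (encode true x); rewrite ?recodeE // imset_f.
Qed.

Lemma recode_swc : preserves_swc G (code true) recode.
Proof.
move=> _ /imsetP[x _ ->] O _; rewrite recodeE /swc.
by congr _%:R; rewrite !card_encode count_columns_eq.
Qed.

(** A monomial extension would match a column of the positive part with a [G]-translate of a column
    of the negative part, whereas [h] has the same sign along a [G]-orbit. *)
Lemma not_extension : (exists a, h a != 0) -> ~ extension_property A G.
Proof.
move=> [a ha] /(_ n (code true) (code false) recode (linear_code_code _)
  (linear_code_code _) recode_isom recode_swc)[T [sigma [tau [tauG ET]]] Tf].
have n_gt0 : (0 < n)%N.
  rewrite -(size_columns_n (h a < 0)) -has_predT.
  by apply/hasP; exists a => //; rewrite mem_columns ha eqxx.
pose i := Ordinal n_gt0.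
have Ecol : column false i = pointwise (tau i) (column true (sigma i)).
  (* Encoding the unit vector at [j] reads off entry [j] of every column. *)
  apply/ffunP=> j; rewrite ffunE -!pair_sum_delta.
  set x := [ffun _ => _].
  have Cx : encode true x \in code true by apply: imset_f.
  have /(congr1 (fun z : {ffun 'I_n -> A} => z i)) := Tf _ Cx.
  by rewrite recodeE ET !ffunE.
have := mem_column false i; have := mem_column true (sigma i).
by rewrite !mem_columns Ecol h_inv // => /andP[_ /eqP->] /andP[_].
Qed.

End Codes.
End Pairing.

Theorem extension_generating_char (G : {group {perm A}}) :
  G \subset autR A -> extension_property A G ->
  exists chi, generating_char [set: A] chi.
Proof.
move=> linG ext; pose I := Iirr [set: A].
pose theta (a : {ffun I -> A}) := \prod_i 'chi[[set: A]]_i (a i).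
have theta_char : additive_char theta.
  split=> [|a b]; rewrite /theta.
    by apply: big1 => i _; rewrite ffunE; case: (irr_additive_char i).
  rewrite -big_split; apply: eq_bigr => i _.
  by rewrite ffunE (irr_additive_char i).2.
have [/forallP ker | /forallPn[x triv]] := boolP
    [forall x : {ffun I -> R}, [exists a in pair_ker x, theta a != 1]].
  have [|h [h_bal h_inv h_neq0]] := exists_balanced linG theta_char.
    by move=> x; have /exists_inP := ker x.
  by case: (not_extension h_bal h_inv h_neq0 ext).
have [|||j _ thetaE] := @char_in_family _ _ xpredT
   (fun j (a : {ffun I -> A}) => 'chi[[set: A]]_j (pair_sum x a))
   (pair_ker x) _ theta _ (card_neq0 A) (pair_ker_zmod x) _ theta_char.
- move=> j _; have := irr_additive_char j.
  exact/additive_char_comp/pair_sumD/pair_sum0.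
- by move=> a; rewrite sum_irr_additive inE.
- move=> a Ka; apply/eqP; apply: contraNT triv => a1.
  by apply/exists_inP; exists a.
(* Evaluate the factorisation of [theta] at the vector with [c] in place [i] and 0 elsewhere. *)
have chiE i c : 'chi[[set: A]]_i c = 'chi[[set: A]]_j (x i *: c).
  rewrite -pair_sum_single -thetaE /theta (bigD1 i) //= ffunE eqxx.
  rewrite big1 ?mulr1 // => k /negPf ki.
  by rewrite ffunE ki (irr_additive_char k).1.
exists (fun a => 'chi[[set: A]]_j a); split=> [|s _ triv_s].
  exact: irr_additive_char.
(* If ['chi_j] is trivial on R s, then every character is trivial at [s], and the regular character
   forces [s = 0]. *)
have E : \sum_i 'chi[[set: A]]_i s = \sum_i 'chi[[set: A]]_i (0 : A).
  by apply: eq_bigr => i _; rewrite chiE triv_s (irr_additive_char i).1.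
apply/eqP; move/eqP: E; rewrite !sum_irr_additive eqxx.
by case: (s == 0) => //; rewrite eq_sym (negPf (card_neq0 A)).
Qed.

End ExtensionImpliesGenerating.

Theorem corollary4p5 (R : finNzRingType) (A : finLmodType R) :
  extension_property A (autR_group A) <-> cyclic_submod (soc A).
Proof.
have [cyclic_gen gen_cyclic] := cyclic_soc_generating A; split=> [ext|].
  exact/gen_cyclic/(extension_generating_char (subxx _)).
by move=> /cyclic_gen[chi]; apply: generating_char_extension.
Qed.
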